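(* Let $\mathscr{C}$ be an infinite collection of irreducible algebraic curves in $\mathbb{P}^2$ of the same degree $d$. Suppose that $\mathrm{Sing}(\mathscr{C})$ is a finite set. Then there exist infinitely many curves in $\mathscr{C}$ that are level sets of the same rational function $F/G$ on $\mathbb{P}^2$.
   Context: $\mathbb{P}^2$ is the complex projective plane with homogeneous coordinates $[z_0:z_1:z_2]$. For a collection $\mathscr{C}$ of irreducible algebraic curves in $\mathbb{P}^2$, a point $p\in\mathbb{P}^2$ is a singularity of $\mathscr{C}$ if either $p$ is a singular point of some curve in $\mathscr{C}$ or $p$ lies in the intersection of two different curves in $\mathscr{C}$; $\mathrm{Sing}(\mathscr{C})$ denotes the set of these singularities. Here $F,G\in\mathbb{C}[z_0,z_1,z_2]$ are homogeneous polynomials of the same degree with $F/G$ non-constant, and a level set of $F/G$ is understood as a curve $\{\alpha F+\beta G=0\}$, $[\alpha:\beta]\in\mathbb{P}^1$, of the pencil generated by $F$ and $G$. *)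

(* Defs.v *)
From HB Require Import structures.
From mathcomp Require Import all_boot all_order all_algebra fraction.
From mathcomp Require Import boolp classical_sets cardinality reals.
From mathcomp Require Import complex.
From mathcomp Require Import mpoly.

Set Implicit Arguments.
Unset Strict Implicit.
Unset Printing Implicit Defensive.

Import GRing.Theory.

Local Open Scope classical_set_scope.
Local Open Scope ring_scope.

Local Notation "x %:F" := (FracField.tofrac x) : ring_scope.

(* P^2 is the set of lines through the origin of C^3; the point [z0:z1:z2] is
   the line spanned by (z0, z1, z2) <> 0. *)
Definition P2 (R : realType) : Type :=
  {L : {vspace 'rV[R[i]]_3} | \dim L == 1%N}.

Definition homogeneous_coords (R : realType) (p : P2 R) (z : 'rV[R[i]]_3) : Prop :=
  z != 0 /\ sval p = <[z]>%VS.

(* For f homogeneous, whether f(z) = 0 does not depend on the choice of the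
   homogeneous coordinates z of p. *)
Definition vanishes_at (R : realType) (f : {mpoly R[i][3]}) (p : P2 R) : Prop :=
  forall z, homogeneous_coords p z -> f.@[fun i => z ord0 i] = 0.

Definition zero_locus (R : realType) (f : {mpoly R[i][3]}) : set (P2 R) :=
  [set p | vanishes_at f p].

Definition irreducible_mpoly (R : realType) (f : {mpoly R[i][3]}) : Prop :=
  [/\ f != 0, f \isn't a GRing.unit &
      forall g h : {mpoly R[i][3]},
        f = g * h -> g \is a GRing.unit \/ h \is a GRing.unit].

(* By the Nullstellensatz, an irreducible equation of C is unique up to a
   nonzero scalar, so the degree and the singular points of C, defined from
   such an equation, depend only on C. *)
Definition irreducible_equation (R : realType) (d : nat)
    (f : {mpoly R[i][3]}) (C : set (P2 R)) : Prop :=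
  [/\ f \is d.-homog, irreducible_mpoly f & C = zero_locus f].

Definition irreducible_curve (R : realType) (d : nat) (C : set (P2 R)) : Prop :=
  exists f, irreducible_equation d f C.

Definition singular_point (R : realType) (C : set (P2 R)) (p : P2 R) : Prop :=
  C p /\
  exists d f, irreducible_equation d f C /\
    forall i : 'I_3, vanishes_at (f^`M(i)) p.

Definition Sing (R : realType) (CC : set (set (P2 R))) : set (P2 R) :=
  [set p | (exists2 C, CC C & singular_point C p) \/
           (exists C D, [/\ CC C, CC D, C <> D & (C `&` D) p])].

Definition nonconstant_quotient (R : realType) (F G : {mpoly R[i][3]}) : Prop :=
  G != 0 /\ forall c : R[i], F%:F / G%:F <> (c%:MP)%:F.

Definition level_set (R : realType) (F G : {mpoly R[i][3]}) (C : set (P2 R)) : Prop :=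
  exists a b : R[i],
    (a, b) != (0, 0) /\ C = zero_locus (a *: F + b *: G).

(* Main.v *)
Require Import Defs.
From HB Require Import structures.
From mathcomp Require Import all_boot all_order all_algebra fraction.
From mathcomp Require Import boolp classical_sets cardinality reals.
From mathcomp Require Import complex.
From mathcomp Require Import mpoly.
From mathcomp Require Import closed_field ring.

Set Implicit Arguments.
Unset Strict Implicit.
Unset Printing Implicit Defensive.

Import Order.TTheory GRing.Theory Num.Theory.

Local Open Scope ring_scope.

(* Fix a curve f = 0 of the collection. Off a finite set of abscissas the other
   curves g = 0 do not meet it, so each g divides, in the coordinate domain of
   f = 0, one and the same polynomial c(x), with a cofactor of bounded degree.
   In such a domain c has, up to scalars, only finitely many divisors of bounded
   degree: they form an algebraic set which is bounded (by linear algebra on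
   supports of vectors of values), and by quantifier elimination a bounded
   algebraic set is finite. Hence infinitely many g are proportional modulo f,
   and having the same degree as f they lie in a single pencil through f. *)

(** * Bounded algebraic sets and units in spaces of vectors *)

(** The coordinate domain of f = 0 need not be factorial, so the divisors of c cannot be counted by
    factoring it. What is used instead is the absence of zero divisors. Polynomials of bounded
    degree are replaced by their values at enough points of the curve; there g h = c becomes a
    coordinatewise equation between vectors of two linear spaces, and scalars are removed by
    prescribing the value 1 at one point. If such g were unbounded, g and h suitably rescaled would
    tend to nonzero vectors with coordinatewise product 0, which a domain forbids; splitting the
    coordinates by size is an effective form of this compactness argument. *)

Lemma rterm_univariate (K : fieldType) (t : GRing.term K) :
  GRing.rterm t -> exists p : {poly K}, forall x, GRing.eval [:: x] t = p.[x].
Proof.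
elim: t => //=.
- case=> [|i] _; first by exists 'X => x; rewrite hornerX.
  (* A variable of positive index is read beyond the end of the environment and takes the default
     value 0. *)
  by exists 0 => x; rewrite horner0; case: i.
- by move=> c _; exists c%:P => x; rewrite hornerC.
- by move=> n _; exists n%:R%:P => x; rewrite hornerC.
- move=> t IHt u IHu /andP[/IHt[p Hp] /IHu[q Hq]].
  by exists (p + q) => x; rewrite hornerD Hp Hq.
- by move=> t IHt /IHt[p Hp]; exists (- p) => x; rewrite hornerN Hp.
- by move=> t IHt n /IHt[p Hp]; exists (p *+ n) => x; rewrite hornerMn Hp.
- move=> t IHt u IHu /andP[/IHt[p Hp] /IHu[q Hq]].
  by exists (p * q) => x; rewrite hornerM Hp Hq.
- by move=> t IHt n /IHt[p Hp]; exists (p ^+ n) => x; rewrite horner_exp Hp.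
Qed.

(** An equation between two polynomials is an identity or fails off the roots of their difference; a
    connective multiplies the exceptional polynomials of its arguments. *)
Lemma qf_generically_constant (K : fieldType) (f : GRing.formula K) :
  GRing.qf_form f -> GRing.rformula f ->
  exists2 p : {poly K}, p != 0 &
    exists b, forall x, p.[x] != 0 -> GRing.qf_eval [:: x] f = b.
Proof.
elim: f => //=.
- by move=> b _ _; exists 1; [exact: oner_neq0 | exists b].
- move=> t u _ /andP[/rterm_univariate[p Hp] /rterm_univariate[q Hq]].
  have [epq|neq_pq] := eqVneq p q.
    by exists 1; [exact: oner_neq0 | exists true => x _; rewrite Hp Hq epq eqxx].
  exists (p - q); first by rewrite subr_eq0.
  by exists false => x; rewrite hornerD hornerN subr_eq0 Hp Hq => /negbTE.
- move=> f IHf g IHg /andP[qf qg] /andP[rf rg].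
  have [p pN0 [b Hb]] := IHf qf rf; have [q qN0 [c Hc]] := IHg qg rg.
  exists (p * q); first exact: mulf_neq0.
  exists (b && c) => x; rewrite hornerM mulf_eq0 negb_or => /andP[px qx].
  by rewrite Hb ?Hc.
- move=> f IHf g IHg /andP[qf qg] /andP[rf rg].
  have [p pN0 [b Hb]] := IHf qf rf; have [q qN0 [c Hc]] := IHg qg rg.
  exists (p * q); first exact: mulf_neq0.
  exists (b || c) => x; rewrite hornerM mulf_eq0 negb_or => /andP[px qx].
  by rewrite Hb ?Hc.
- move=> f IHf g IHg /andP[qf qg] /andP[rf rg].
  have [p pN0 [b Hb]] := IHf qf rf; have [q qN0 [c Hc]] := IHg qg rg.
  exists (p * q); first exact: mulf_neq0.
  exists (b ==> c) => x; rewrite hornerM mulf_eq0 negb_or => /andP[px qx].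
  by rewrite Hb ?Hc.
move=> f IHf qf rf; have [p pN0 [b Hb]] := IHf qf rf.
by exists p => //; exists (~~ b) => x px; rewrite Hb.
Qed.

(* Chevalley: quantifier elimination makes a definable subset of the line finite
   or cofinite, and a cofinite one is unbounded. *)
Lemma bounded_definable_finite (K : numClosedFieldType) (f : GRing.formula K)
    (B : K) :
  GRing.rformula f -> (forall x, GRing.holds [:: x] f -> `|x| <= B) ->
  exists s : seq K, forall x, GRing.holds [:: x] f -> x \in s.
Proof.
move=> rf fB.
pose elim := GRing.quantifier_elim (@ClosedFieldQE.ex_elim K).
have wf := @ClosedFieldQE.wf_ex_elim K.
have ok := ClosedFieldQE.holds_ex_elim (@solve_monicpoly K).
have /andP[qff rff] := GRing.quantifier_elim_wf wf rf.
have [p pN0 [b Hb]] := qf_generically_constant qff rff.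
have [s Hs] := closed_field_poly_normal p.
have in_s x : (x \in s) = (p.[x] == 0).
  rewrite -rootE Hs rootZ ?lead_coef_eq0 //.
  by rewrite root_prod_XsubC.
have holdsE x : x \notin s -> GRing.holds [:: x] f <-> b.
  rewrite in_s => /Hb <-.
  by have holdsP := GRing.quantifier_elim_rformP wf ok [:: x] rf; split=> /holdsP.
case: b {Hb} holdsE => holdsE; last first.
  by exists s => x fx; apply/negPn/negP => /holdsE/iffLR/(_ fx).
(* One more point than [s] has elements, all of absolute value beyond [B]: one of them escapes
   [s]. *)
pose t := [seq (`|B| + i.+1%:R : K) | i <- iota 0 (size s).+1].
have ut : uniq t.
  rewrite map_inj_uniq ?iota_uniq // => i j /addrI/eqP.
  by rewrite eqr_nat eqSS => /eqP.
have [ts|/allPn[x xt xs]] := boolP (all (mem s) t).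
  have := uniq_leq_size ut (allP ts).
  by rewrite size_map size_iota ltnn.
have := fB x (iffRL (holdsE x xs) isT).
move: xt => /mapP[i _ ->] le_B; exfalso.
have B0 : 0 <= B by apply: le_trans le_B; exact: normr_ge0.
move: le_B; rewrite !ger0_norm ?addr_ge0 ?normr_ge0 //.
by rewrite gerDl lern0.
Qed.

(** Let [N] be [M] with the columns in [J] cleared. Either [M] does not kill the kernel of [N],
    which gives a nonzero vector supported in [J], or [M] factors as [N *m Q] and the entries of [Q]
    provide the constant. *)
Lemma row_space_support (K : numFieldType) a c (M : 'M[K]_(a, c))
    (J : {set 'I_c}) :
  (exists u : 'rV_a, u *m M != 0 /\ forall j, j \notin J -> (u *m M) 0 j = 0) \/
  (exists2 C : K, 0 <= C & forall (u : 'rV_a) B, 0 <= B ->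
     (forall j, j \notin J -> `|(u *m M) 0 j| <= B) ->
     forall j, `|(u *m M) 0 j| <= C * B).
Proof.
pose N := \matrix_(i, j) (if j \in J then 0 else M i j).
have NE (u : 'rV_a) j : (u *m N) 0 j = if j \in J then 0 else (u *m M) 0 j.
  rewrite !mxE; case: ifP => jJ.
    by rewrite big1 // => i _; rewrite mxE jJ mulr0.
  by apply: eq_bigr => i _; rewrite mxE jJ.
have [ker0|/rowV0Pn[v /submxP[w ->] vMN0]] := eqVneq (kermx N *m M) 0; last first.
  left; exists (w *m kermx N); split; first by rewrite -mulmxA.
  move=> j jJ; have := NE (w *m kermx N) j.
  by rewrite (negbTE jJ) -mulmxA mulmx_ker mulmx0 mxE.
right; pose Q := pinvmx N *m M.
have MNQ : M = N *m Q.
  apply/eqP; rewrite -subr_eq0 mulmxA -{1}[M]mul1mx -mulmxBl.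
  have /submxP[w ->] : (1%:M - N *m pinvmx N <= kermx N)%MS.
    by apply/sub_kermxP; rewrite mulmxBl mul1mx mulmxKpV ?subrr.
  by rewrite -mulmxA ker0 mulmx0.
exists (\sum_i \sum_j `|Q i j|).
  by do 2 (apply: sumr_ge0 => ? _); exact: normr_ge0.
move=> u B B0 uB j; rewrite {1}MNQ mulmxA mxE.
rewrite mulr_suml; apply: le_trans (ler_norm_sum _ _ _) _.
apply: ler_sum => i _; rewrite normrM mulrC.
apply: ler_pM; rewrite ?normr_ge0 //.
  by rewrite (bigD1 j) //= lerDl sumr_ge0.
by rewrite NE; case: ifPn => [_|/uB //]; rewrite normr0.
Qed.

(* No gap: splitting the coordinates at a threshold t according to the size of
   g j, either the large ones are controlled by the small ones, hence by t, or
   the small nu j / g j are all controlled, which bounds g i0 = 1 away from 0;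
   otherwise U and V contain nonzero vectors with disjoint supports. *)
Lemma row_space_units_bounded (K : numClosedFieldType) a b c
    (M : 'M[K]_(a, c)) (N : 'M[K]_(b, c)) (nu : 'I_c -> K) (i0 : 'I_c) :
  (forall (u : 'rV_a) (v : 'rV_b), (forall j, (u *m M) 0 j * (v *m N) 0 j = 0) ->
     u *m M = 0 \/ v *m N = 0) ->
  nu i0 != 0 ->
  exists B : K, forall (u : 'rV_a) (v : 'rV_b),
    (forall j, (u *m M) 0 j * (v *m N) 0 j = nu j) -> (u *m M) 0 i0 = 1 ->
    forall j, `|(u *m M) 0 j| <= B.
Proof.
move=> nondeg nu0.
(* Summing over the finitely many [J] gives one constant valid for all of them; it has to be known
   before the threshold [t], on which [J] depends. *)
have ctrl d (P : 'M[K]_(d, c)) : exists2 C : K, 0 <= C & forall J : {set 'I_c},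
    (exists u : 'rV_d, u *m P != 0 /\ forall j, j \notin J -> (u *m P) 0 j = 0)
    \/ (forall (u : 'rV_d) B, 0 <= B ->
     (forall j, j \notin J -> `|(u *m P) 0 j| <= B) ->
     forall j, `|(u *m P) 0 j| <= C * B).
  have /fin_all_exists[C HC] (J : {set 'I_c}) : exists C : K, 0 <= C /\
      ((exists u : 'rV_d, u *m P != 0 /\
          forall j, j \notin J -> (u *m P) 0 j = 0)
      \/ (forall (u : 'rV_d) B, 0 <= B ->
       (forall j, j \notin J -> `|(u *m P) 0 j| <= B) ->
       forall j, `|(u *m P) 0 j| <= C * B)).
    by have [?|[C C0 HC]] := row_space_support P J; [exists 0 | exists C];
      split=> //; [left | right].
  exists (\sum_J C J); first by apply: sumr_ge0 => J _; case: (HC J).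
  move=> J; have [_ [?|HJ]] := HC J; [by left | right => u B B0 uB j].
  apply: le_trans (HJ u B B0 uB j) _; apply: ler_wpM2r => //.
  by rewrite (bigD1 J) //= lerDl sumr_ge0 // => J' _; case: (HC J').
have [C C0 HC] := ctrl _ M; have [D D0 HD] := ctrl _ N.
pose S := \sum_j `|nu j|.
have S0 : 0 <= S by apply: sumr_ge0 => j _; exact: normr_ge0.
have DS0 : 0 <= D * S by exact: mulr_ge0.
(* Makes [D * (S / t)] smaller than the absolute value of [nu i0], against the bound on
   [(v *m N) 0 i0] that control by the coordinates in [J] would give. *)
pose t := (D * S + 1) / `|nu i0|.
have t0 : 0 < t by rewrite divr_gt0 ?normr_gt0 // ltr_wpDl.
exists (C * t) => u v uvnu ui0.
pose J := [set j | ~~ (`|(u *m M) 0 j| <= t)].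
have J_gt j : j \in J -> t < `|(u *m M) 0 j|.
  by rewrite inE -real_ltNge ?normr_real ?gtr0_real.
have [[u' [u'0 u'J]]|ctrlM] := HC J; last first.
  by apply: ctrlM; [exact: ltW | move=> j; rewrite inE negbK].
have [[v' [v'0 v'J]]|ctrlN] := HD (~: J).
  have [|/eqP|/eqP] := nondeg u' v'; rewrite ?(negbTE u'0) ?(negbTE v'0) //.
  move=> j; have [jJ|jJ] := boolP (j \in J).
    by rewrite v'J ?mulr0 // inE negbK.
  by rewrite u'J ?mul0r.
suff /ctrlN/(_ i0) : forall j, j \notin ~: J -> `|(v *m N) 0 j| <= S / t.
  have -> : (v *m N) 0 i0 = nu i0 by rewrite -uvnu ui0 mul1r.
  move=> /(_ (divr_ge0 S0 (ltW t0))).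
  rewrite mulrA ler_pdivlMr // mulrC /t mulfVK ?normr_eq0 //.
  by rewrite gerDl ler10.
move=> j; rewrite inE negbK => /J_gt tj.
rewrite ler_pdivlMr // (le_trans (y := `|nu j|)) //.
  by rewrite -uvnu normrM mulrC ler_wpM2r ?normr_ge0 // ltW.
by rewrite /S (bigD1 j) //= lerDl sumr_ge0.
Qed.

Lemma holds_bigAnd (K : fieldType) (I : eqType) (s : seq I)
    (F : I -> GRing.formula K) e :
  GRing.holds e (\big[GRing.And/GRing.Bool true]_(i <- s) F i) <->
  (forall i, i \in s -> GRing.holds e (F i)).
Proof.
elim: s => [|i s IHs]; first by rewrite big_nil.
rewrite big_cons /=; split=> [[Fi /IHs Fs] j|Fs].
  by rewrite inE => /predU1P[->|/Fs].
by split=> [|]; [|apply/IHs => j js]; apply: Fs; rewrite inE ?eqxx ?js ?orbT.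
Qed.

Section LinearTerms.
Variables (K : fieldType) (a c : nat) (M : 'M[K]_(a, c)) (k : nat).

(* The j-th entry of u *m M, the entries of u being the variables X_k, X_(k+1),
   ..., X_(k+a-1). *)
Definition row_term (j : 'I_c) : GRing.term K :=
  \big[@GRing.Add K/GRing.Const 0]_(i < a)
     GRing.Mul (GRing.Const (M i j)) (GRing.Var K (k + i)).

Lemma row_term_rterm j : GRing.rterm (row_term j).
Proof. by apply: (big_ind (fun t => GRing.rterm t)) => //= x y -> ->. Qed.

Lemma eval_row_term e (u : 'rV[K]_a) j :
  (forall i : 'I_a, e`_(k + i) = u 0 i) ->
  GRing.eval e (row_term j) = (u *m M) 0 j.
Proof.
move=> eu; rewrite mxE (big_morph (GRing.eval e) (id1 := 0) (op1 := +%R)) //.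
by apply: eq_bigr => i _ /=; rewrite eu mulrC.
Qed.

End LinearTerms.

(* For graded domains of functions this says that an element has finitely many
   divisors of a given degree, up to scalars. *)
Lemma row_space_units_finite (K : numClosedFieldType) a b c
    (M : 'M[K]_(a, c)) (N : 'M[K]_(b, c)) (nu : 'I_c -> K) (i0 : 'I_c) :
  (forall (u : 'rV_a) (v : 'rV_b), (forall j, (u *m M) 0 j * (v *m N) 0 j = 0) ->
     u *m M = 0 \/ v *m N = 0) ->
  nu i0 != 0 ->
  exists s : seq 'rV[K]_c, forall (u : 'rV_a) (v : 'rV_b),
    (forall j, (u *m M) 0 j * (v *m N) 0 j = nu j) ->
    (u *m M) 0 i0 = 1 -> u *m M \in s.
Proof.
move=> nondeg nu0; have [B HB] := row_space_units_bounded nondeg nu0.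
(* Variable 0 is the coordinate under study, variables 1 to [a] hold [u] and variables [a + 1] to
   [a + b] hold [v]. *)
pose g j := row_term M 1 j; pose h j := row_term N a.+1 j.
pose f j := foldr GRing.Exists (GRing.And (GRing.Equal (GRing.Var K 0) (g j))
  (GRing.And (GRing.Equal (g i0) (GRing.Const 1))
    (\big[GRing.And/GRing.Bool true]_(l <- enum 'I_c)
        GRing.Equal (GRing.Mul (g l) (h l)) (GRing.Const (nu l)))))
  (iota 1 (a + b)).
have rf j : GRing.rformula (f j).
  rewrite /f; elim: (iota _ _) => //=; rewrite !row_term_rterm /=.
  apply: (big_ind (fun t => GRing.rformula t)) => [//|x y /= -> -> //|l _ /=].
  by rewrite !row_term_rterm.
have fP j x : GRing.holds [:: x] (f j) <-> exists (u : 'rV_a) (v : 'rV_b),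
  [/\ forall l, (u *m M) 0 l * (v *m N) 0 l = nu l, (u *m M) 0 i0 = 1 &
      x = (u *m M) 0 j].
  split=> [/GRing.foldExistsP[e eqe] /= [e0 [ei0 /holds_bigAnd eall]]|].
    pose u := \row_(i < a) e`_(1 + i); pose v := \row_(i < b) e`_(a.+1 + i).
    have gE l : GRing.eval e (g l) = (u *m M) 0 l.
      by apply: eval_row_term => i; rewrite mxE.
    have hE l : GRing.eval e (h l) = (v *m N) 0 l.
      by apply: eval_row_term => i; rewrite mxE.
    exists u, v; split; rewrite -?gE //.
      by move=> l; rewrite -gE -hE; apply: eall; rewrite mem_enum.
    by rewrite -e0 -eqe // inE /= mem_iota.
  move=> [u [v [uv ui0 ->]]]; pose e := (u *m M) 0 j :: [seq u 0 i | i <- enum 'I_a]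
                         ++ [seq v 0 i | i <- enum 'I_b].
  have gE l : GRing.eval e (g l) = (u *m M) 0 l.
    apply: eval_row_term => i; rewrite /= add0n nth_cat size_map size_enum_ord ltn_ord.
    by rewrite (nth_map i) ?size_enum_ord // nth_ord_enum.
  have hE l : GRing.eval e (h l) = (v *m N) 0 l.
    apply: eval_row_term => i; rewrite /= nth_cat size_map size_enum_ord.
    rewrite ltnNge leq_addr /= addKn.
    by rewrite (nth_map i) ?size_enum_ord // nth_ord_enum.
  apply/GRing.foldExistsP; exists e.
    move=> [|i] //; rewrite inE /= mem_iota /= -leqNgt addSn ltnS => le_ab_i.
    by rewrite [RHS]nth_default ?nth_nil // size_cat !size_map -!enumT !size_enum_ord.
  split; first by rewrite /= gE.
  split; first by rewrite /= gE.
  by apply/holds_bigAnd => l _ /=; rewrite gE hE.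
have /fin_all_exists[s Hs] j : exists s : seq K,
    forall x, GRing.holds [:: x] (f j) -> x \in s.
  apply: (bounded_definable_finite (B := B)) => // x /fP[u [v [uv ui0 ->]]].
  exact: HB uv ui0 j.
(* Each coordinate lies in its own finite list, so a vector is coded by its indices in these lists,
   all at most [n]. *)
pose n := \sum_j size (s j).
exists [seq \row_j (s j)`_(k j) | k : {ffun 'I_c -> 'I_n.+1}] => u v uv ui0.
have us j : (u *m M) 0 j \in s j by apply/Hs/fP; exists u, v.
apply/mapP; exists [ffun j => inord (index ((u *m M) 0 j) (s j))].
  by rewrite mem_enum.
apply/rowP => j; rewrite [RHS]mxE ffunE inordK ?nth_index //.
rewrite ltnS (leq_trans (index_size _ _)) //.
by rewrite /n (bigD1 j) //= leq_addr.
Qed.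

(** * Plane curves in affine coordinates *)

(* MathComp's [%|] on {poly {poly K}} is pseudo-divisibility, which ignores
   factors from {poly K}. *)
Definition divides (A : comNzRingType) (f g : A) : Prop := exists k, g = f * k.

Lemma divides_mull (A : comNzRingType) (f g h : A) :
  divides f g -> divides f (h * g).
Proof. by move=> [k ->]; exists (h * k); rewrite mulrCA. Qed.

Lemma divides_add (A : comNzRingType) (f g h : A) :
  divides f g -> divides f h -> divides f (g + h).
Proof. by move=> [k ->] [l ->]; exists (k + l); rewrite mulrDr. Qed.

Section Bivariate.
Variable K : closedFieldType.
Implicit Types (f g a b w : {poly {poly K}}) (c r : {poly K}) (x y : K).

Local Notation fiber x := (map_poly (horner_eval x)).

Lemma horner_fiber x y w : (fiber x w).[y] = w.[y%:P].[x].
Proof.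
rewrite -[RHS]/(horner_eval x _) -horner_map /=.
by rewrite /horner_eval hornerC.
Qed.

Lemma fiber_eq0 x w : fiber x w = 0 -> divides ('X - x%:P)%:P w.
Proof.
move=> w0; exists (map_poly (fun c => c %/ ('X - x%:P)) w).
apply/polyP => i; rewrite mul_polyC coefZ coef_map_id0 ?div0p //.
rewrite mulrC divpK // dvdp_XsubCl rootE.
by have := congr1 (fun p : {poly K} => p`_i) w0; rewrite coef_map coef0 => /eqP.
Qed.

Lemma polyC_mulI c f g : c != 0 -> c%:P * f = c%:P * g -> f = g.
Proof. by move=> c0; apply: mulfI; rewrite polyC_eq0. Qed.

(** Reduces cancellation of a polynomial in the inner variable to that of one linear factor, which
    is tested on a single fiber. *)
Lemma poly_root_ind (P : {poly K} -> Prop) :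
  (forall x : K, x != 0 -> P x%:P) ->
  (forall x c, c != 0 -> P c -> P (('X - x%:P) * c)) ->
  forall c, c != 0 -> P c.
Proof.
move=> Pconst Pmul c; have [s ->] := closed_field_poly_normal c.
rewrite scaler_eq0 lead_coef_eq0 negb_or => /andP[c0 _].
elim: s => [|x s IHs].
  by rewrite big_nil alg_polyC; apply: Pconst; rewrite lead_coef_eq0.
rewrite big_cons scalerAr; apply: Pmul IHs.
rewrite scaler_eq0 lead_coef_eq0 negb_or c0 /=.
by rewrite -size_poly_gt0 size_prod_XsubC.
Qed.

(** Modulo ['X - x%:P] the product becomes one in the domain K[y], so the linear factor divides [a]
    or [b] and can be cancelled there without changing the degree in the outer variable. *)
Lemma polyC_factorization c f a b : c != 0 -> c%:P * f = a * b ->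
  exists a' b', [/\ f = a' * b', size a' = size a & size b' = size b].
Proof.
move=> c0; elim/poly_root_ind: c0 a b => [x x0|x {}c c0 IHc] a b.
  move=> xf; exists (x^-1%:P%:P * a), b; split=> //.
    by rewrite -mulrA -xf mulrA -!polyCM mulVf ?mul1r.
  by rewrite mul_polyC size_scale // polyC_eq0 invr_eq0.
rewrite polyCM -mulrA => xcf.
have := congr1 (map_poly (horner_eval x)) xcf.
rewrite !rmorphM /= map_polyC /= /horner_eval hornerXsubC subrr mul0r.
have size_Xsub w : size (('X - x%:P)%:P * w) = size w.
  by rewrite mul_polyC size_scale // polyXsubC_eq0.
have X0 : 'X - x%:P != 0 by rewrite polyXsubC_eq0.
move=> /esym/eqP; rewrite mulf_eq0 => /orP[]/eqP/fiber_eq0[w] def.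
  have /IHc[a' [b' [-> sa sb]]] : c%:P * f = w * b.
    by apply: (polyC_mulI X0); rewrite xcf def mulrA.
  by exists a', b'; rewrite def size_Xsub sa sb.
have /IHc[a' [b' [-> sa sb]]] : c%:P * f = a * w.
  by apply: (polyC_mulI X0); rewrite xcf def mulrCA.
by exists a', b'; rewrite def size_Xsub sa sb.
Qed.

(** * Irreducible bivariate polynomials are prime *)

Section Irreducible.
Variable f : {poly {poly K}}.
Hypothesis f_irr : forall a b, f = a * b ->
  a \is a GRing.unit \/ b \is a GRing.unit.
Hypothesis f_deg : (1 < size f)%N.

Let f_neq0 : f != 0. Proof. by rewrite -size_poly_gt0 ltnW. Qed.

Lemma fiber_irr_neq0 x : fiber x f != 0.
Proof.
apply/eqP => /fiber_eq0[w fE]; have [] := f_irr fE; rewrite poly_unitE.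
  rewrite coefC /= poly_unitE size_XsubC /=; case/andP => _; by [].
move=> /andP[/eqP sw _]; move: f_deg; rewrite fE mul_polyC size_scale ?sw //.
by rewrite polyXsubC_eq0.
Qed.

(** No fiber of [f] is zero, so each linear factor of [c] has to divide the cofactor of [f]. *)
Lemma irr_divides_polyC c g : c != 0 -> divides f (c%:P * g) -> divides f g.
Proof.
move=> c0; elim/poly_root_ind: c0 g => [x x0|x {}c c0 IHc] g [k fk].
  exists (x^-1%:P%:P * k); rewrite mulrCA -fk mulrA -!polyCM.
  by rewrite mulVf ?mul1r.
move: fk; rewrite polyCM -mulrA => xcg.
have := congr1 (map_poly (horner_eval x)) xcg.
rewrite !rmorphM /= map_polyC /= /horner_eval hornerXsubC subrr mul0r.
move=> /esym/eqP; rewrite mulf_eq0 (negbTE (fiber_irr_neq0 x)) /=.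
move=> /eqP/fiber_eq0[w kE]; apply: IHc; exists w.
have X0 : 'X - x%:P != 0 by rewrite polyXsubC_eq0.
by apply: (polyC_mulI X0); rewrite xcg kE mulrCA.
Qed.

(* Gauss's lemma: f stays irreducible over the field K(x). *)
Lemma irr_divides_or_Bezout g : divides f g \/
  exists r u v, r != 0 /\ r%:P = u * f + v * g.
Proof.
have [|ncop] := boolP (coprimep f g).
  move=> /Bezout_coprimepP[[u v] /= /eqpP[[c r] /= /andP[c0 r0] E]]; right.
  exists r, (c%:P * u), (c%:P * v); split=> //.
  by rewrite -!mulrA -mulrDr mul_polyC E alg_polyC.
left; pose h := gcdp f g.
have /Pdiv.Idomain.dvdpP[[c q] /= c0] := dvdp_gcdl f g; rewrite -/h => cf.
have /Pdiv.Idomain.dvdpP[[c' q'] /= c'0] := dvdp_gcdr f g; rewrite -/h => c'g.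
have h0 : h != 0 by rewrite gcdp_eq0 negb_and f_neq0.
rewrite -!mul_polyC in cf c'g.
have [q1 [h1 [fE sq sh]]] := polyC_factorization c0 cf.
(* One of [q1], [h1] is a unit; it is not [h1], which has the positive degree of the gcd. So [f] is
   the gcd up to factors from K[x]. *)
have sq1 : size q = 1.
  rewrite -sq; have [|] := f_irr fE; rewrite poly_unitE => /andP[/eqP sz _] //.
  by move: ncop; rewrite /coprimep -/h -sh sz eqxx.
pose d := q`_0; have qE : q = d%:P by apply/size1_polyC/eq_leq.
have d0 : d != 0 by rewrite -polyC_eq0 -qE -size_poly_gt0 sq1.
apply: (@irr_divides_polyC (c' * d)); first exact: mulf_neq0.
exists (q' * c%:P); rewrite mulrCA [f * _]mulrC cf qE polyCM -mulrA.
by rewrite mulrCA c'g mulrCA.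
Qed.

Lemma irr_prime g h : divides f (g * h) -> divides f g \/ divides f h.
Proof.
move=> fgh; have [|[r [u [v [r0 rE]]]]] := irr_divides_or_Bezout g; first by left.
right; apply: (irr_divides_polyC r0); rewrite rE mulrDl; apply: divides_add.
  by exists (u * h); rewrite mulrCA mulrA.
by rewrite -mulrA; apply: divides_mull.
Qed.

End Irreducible.

(** Sizes exceed degrees by one: the degree is less than [p] in the outer variable and less than [q]
    in the inner one. *)
Definition bideg_lt p q w := (size w <= p)%N /\ forall i, leq (size w`_i) q.

Lemma bideg_ltM p q p' q' w w' : bideg_lt p q w -> bideg_lt p' q' w' ->
  bideg_lt (p + p').-1 (q + q') (w * w').
Proof.
move=> [sw cw] [sw' cw']; split.
  by rewrite (leq_trans (size_polyMleq _ _)) // -!subn1 leq_sub2r ?leq_add.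
move=> i; rewrite coefM; apply: (leq_trans (size_sum _ _ _)).
apply/bigmax_leqP => j _; rewrite (leq_trans (size_polyMleq _ _)) //.
by rewrite (leq_trans (leq_pred _)) ?leq_add.
Qed.

Lemma bideg_lt_sub p q w w' :
  bideg_lt p q w -> bideg_lt p q w' -> bideg_lt p q (w - w').
Proof.
move=> [sw cw] [sw' cw']; split=> [|i].
  by rewrite (leq_trans (size_polyD _ _)) // size_polyN geq_max sw.
by rewrite coefB (leq_trans (size_polyD _ _)) // size_polyN geq_max cw cw'.
Qed.

Lemma bideg_ltW p q p' q' w : (p <= p')%N -> (q <= q')%N ->
  bideg_lt p q w -> bideg_lt p' q' w.
Proof.
by move=> pp qq [sw cw]; split=> [|i]; [exact: leq_trans pp|exact: leq_trans qq].
Qed.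

Lemma bideg_ltC q c : (size c <= q)%N -> bideg_lt 1 q c%:P.
Proof.
move=> cq; split=> [|i]; first exact: size_polyC_leq1.
by rewrite coefC; case: eqP => // _; rewrite size_poly0.
Qed.

Lemma bideg_lt_exists w : exists q, bideg_lt (size w) q w.
Proof.
exists (\max_(i < size w) size (w`_i)%R); split=> // i.
have [i_w|w_i] := ltnP i (size w); last by rewrite nth_default ?size_poly0.
exact: (leq_bigmax (Ordinal i_w)).
Qed.

(** Turns polynomials of bounded bidegree into a space of known dimension. The default values of
    [insub] are never reached, the indices being in range. *)
Definition poly_of_mx p q (A : 'M[K]_(p, q)) : {poly {poly K}} :=
  \poly_(i < p) \poly_(j < q) (if insub i is Some i' then
                               if insub j is Some j' then A i' j' else 0 else 0).

Definition mx_of_poly p q w : 'M[K]_(p, q) := \matrix_(i, j) w`_i`_j.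

Lemma coef_poly_of_mx p q (A : 'M[K]_(p, q)) (i : 'I_p) (j : 'I_q) :
  (poly_of_mx A)`_i`_j = A i j.
Proof. by rewrite coef_poly ltn_ord coef_poly ltn_ord !valK. Qed.

Lemma bideg_poly_of_mx p q (A : 'M[K]_(p, q)) : bideg_lt p q (poly_of_mx A).
Proof.
split=> [|i]; first exact: size_poly.
by rewrite coef_poly; case: ifP => _; rewrite ?size_poly0 ?size_poly.
Qed.

Lemma bideg_ltP p q w w' : bideg_lt p q w -> bideg_lt p q w' ->
  (forall (i : 'I_p) (j : 'I_q), w`_i`_j = w'`_i`_j) -> w = w'.
Proof.
move=> [sw cw] [sw' cw'] eqw; apply/polyP => i; apply/polyP => j.
have [ip|pi] := ltnP i p; last first.
    by rewrite (nth_default 0 (leq_trans sw pi)) (nth_default 0 (leq_trans sw' pi)).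
have [jq|qj] := ltnP j q; last first.
    by rewrite (nth_default 0 (leq_trans (cw i) qj))
               (nth_default 0 (leq_trans (cw' i) qj)).
exact: (eqw (Ordinal ip) (Ordinal jq)).
Qed.

Lemma mx_of_polyK p q w : bideg_lt p q w -> poly_of_mx (mx_of_poly p q w) = w.
Proof.
move=> bw; apply: bideg_ltP bw _; first exact: bideg_poly_of_mx.
by move=> i j; rewrite coef_poly_of_mx mxE.
Qed.

Lemma mx_of_poly_eq0 p q w : bideg_lt p q w -> mx_of_poly p q w = 0 -> w = 0.
Proof.
move=> bw w0; apply: bideg_ltP bw _ _.
  by split=> [|i]; rewrite ?coef0 size_poly0.
by move=> i j; have := congr1 (fun A : 'M_(_, _) => A i j) w0; rewrite !mxE !coef0.
Qed.

Lemma poly_of_mx_eq0 p q (A : 'M[K]_(p, q)) : poly_of_mx A = 0 -> A = 0.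
Proof.
by move=> A0; apply/matrixP => i j; rewrite -coef_poly_of_mx A0 !coef0 mxE.
Qed.

Lemma poly_of_mx_linear p q x (A B : 'M[K]_(p, q)) :
  poly_of_mx (x *: A + B) = x%:P%:P * poly_of_mx A + poly_of_mx B.
Proof.
apply/polyP => i; rewrite coefD coefCM; apply/polyP => j.
rewrite coefD coefCM !coef_poly; case: ltnP => ip; last by rewrite !coef0 mulr0 addr0.
rewrite !coef_poly; case: ltnP => jq; last by rewrite mulr0 addr0.
by rewrite (insubT (fun i => i < p)%N ip) (insubT (fun i => i < q)%N jq) !mxE.
Qed.

Lemma mx_of_poly_linear p q x w w' :
  mx_of_poly p q (x%:P%:P * w + w') = x *: mx_of_poly p q w + mx_of_poly p q w'.
Proof. by apply/matrixP => i j; rewrite !mxE coefD coefCM coefD coefCM. Qed.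

Lemma linear_kernel (V W : vectType K) (phi : {linear V -> W}) :
  (\dim {:W} < \dim {:V})%N -> exists v, v != 0 /\ phi v = 0.
Proof.
move=> dWV; have [k0|k0] := eqVneq (lker (linfun phi)) 0%VS.
  have := limg_dim_eq (f := linfun phi) (U := fullv).
  rewrite k0 capv0 => /(_ erefl) dV.
  by have := dimvS (subvf (linfun phi @: fullv)); rewrite dV leqNgt dWV.
exists (vpick (lker (linfun phi))); rewrite vpick0 k0; split=> //.
by have := memv_pick (lker (linfun phi)); rewrite memv_ker lfunE => /eqP.
Qed.

(** * Bezout identities with bounded degrees *)

Section BoundedBezout.
Variables (m l n : nat) (f w : {poly {poly K}}).
(** Stands for the size of a resultant. It depends on the degree bounds alone, hence is common to
    all [w]. *)
Let D := ((m + l) * n).+1.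

Definition Bezout_mx (t : 'M[K]_(1, D) * 'M[K]_(m, D) * 'M[K]_(l, D)) :
    'M[K]_(m + l, D + n) :=
  mx_of_poly (m + l) (D + n)
    (poly_of_mx t.1.1 - (poly_of_mx t.2 * f + poly_of_mx t.1.2 * w)).

Lemma Bezout_mx_linear : linear Bezout_mx.
Proof.
move=> x [[r b] a] [[r' b'] a']; rewrite /Bezout_mx -mx_of_poly_linear /=.
by rewrite !poly_of_mx_linear; congr mx_of_poly; ring.
Qed.

HB.instance Definition _ := GRing.isLinear.Build K
  ('M[K]_(1, D) * 'M[K]_(m, D) * 'M[K]_(l, D))%type 'M[K]_(m + l, D + n) _
  Bezout_mx Bezout_mx_linear.

(* Dimension count: there are D + (m + l) * D unknown coefficients and
   (m + l) * (D + n) linear conditions. *)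
Lemma Bezout_mx_kernel : exists t, t != 0 /\ Bezout_mx t = 0.
Proof.
apply: linear_kernel; rewrite !dimvf.
rewrite -[X in (_ < X)%N]/(dim 'M[K]_(1, D) + dim 'M[K]_(m, D) + dim 'M[K]_(l, D))%N.
rewrite !dim_matrix -[X in is_true X]/((m + l) * (D + n) < 1 * D + m * D + l * D)%N mul1n.
by rewrite mulnDr -addnA -mulnDl [ltnRHS]addnC ltn_add2l.
Qed.

(** A nonzero kernel vector gives the identity. If [r] were 0, then [f] would divide [b * w], hence
    [b], whose degree is less than [m]; so [b], and then [a], would vanish. *)
Lemma bounded_Bezout :
  (forall a b, f = a * b -> a \is a GRing.unit \/ b \is a GRing.unit) ->
  (0 < m)%N -> size f = m.+1 -> bideg_lt m.+1 n f -> bideg_lt l n w ->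
  ~ divides f w ->
  exists r a b, [/\ r != 0, (size r <= D)%N, bideg_lt m D b &
                    r%:P = a * f + b * w].
Proof.
move=> f_irr m0 sf bf bw ndiv; have f_deg : (1 < size f)%N by rewrite sf.
have [[[R B] A] [t0]] := Bezout_mx_kernel.
rewrite /Bezout_mx /=; set a := poly_of_mx A; set b := poly_of_mx B.
have bb : bideg_lt m D b := bideg_poly_of_mx B.
have [sr cr] : bideg_lt 1 D (poly_of_mx R) := bideg_poly_of_mx R.
set r := (poly_of_mx R)`_0; have rE : poly_of_mx R = r%:P by exact: size1_polyC.
rewrite rE => /mx_of_poly_eq0/= E.
have {E} rE' : r%:P = a * f + b * w.
  apply/eqP; rewrite -subr_eq0; apply/eqP/E.
  rewrite opprD addrA; do 2?[apply: bideg_lt_sub].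
  - apply: bideg_ltW (bideg_ltC (cr 0)); last exact: leq_addr.
    by rewrite (leq_trans m0) ?leq_addr.
  - apply: bideg_ltW (bideg_ltM (bideg_poly_of_mx A) bf) => //.
    by rewrite addnS addnC.
  - exact: bideg_ltW (leq_pred _) (leqnn _) (bideg_ltM bb bw).
exists r, a, b; split; [|exact: (cr 0)|by []|by []]; apply/eqP => r0.
have b0 : b = 0.
  have [|[k bE]|//] := irr_prime f_irr f_deg (g := b) (h := w).
    by exists (- a); apply/eqP; rewrite -subr_eq0 mulrN opprK addrC mulrC -rE' r0.
  apply/eqP/negPn/negP => b0; have := bb.1; rewrite leqNgt bE => /negP[].
  move: b0; rewrite bE mulf_eq0 negb_or => /andP[f0 k0].
  by rewrite size_mul // sf addSn /= -addn1 leq_add2l size_poly_gt0.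
have a0 : a = 0.
  have f0 : f != 0 by rewrite -size_poly_gt0 sf.
  apply: (mulIf f0); rewrite mul0r; apply/eqP; move/eqP: rE'.
  by rewrite r0 b0 mul0r addr0 eq_sym.
move: t0; rewrite (poly_of_mx_eq0 a0) (poly_of_mx_eq0 b0).
rewrite (@poly_of_mx_eq0 _ _ R) ?eqxx //.
by rewrite rE r0.
Qed.
End BoundedBezout.

(** * Curves meeting f = 0 only over given abscissas *)

Section CommonZeros.
Variables (f w : {poly {poly K}}) (m : nat) (X : seq K).
Hypothesis size_f : size f = m.+1.
Hypothesis lead_f : forall x, (lead_coef f).[x] = 0 -> x \in X.
Hypothesis fw_zeros : forall x y,
  f.[y%:P].[x] = 0 -> w.[y%:P].[x] = 0 -> x \in X.

Lemma size_fiber x : x \notin X -> size (fiber x f) = m.+1.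
Proof.
move=> xX; rewrite size_map_poly_id0 // /horner_eval.
by apply: contraNneq xX => /lead_f.
Qed.

Lemma coprimep_fiber x : x \notin X -> coprimep (fiber x f) (fiber x w).
Proof.
apply: contraR => /closed_rootP[y]; rewrite root_gcd !rootE !horner_fiber.
by move=> /andP[/eqP fy /eqP/(fw_zeros fy)].
Qed.

(* At a root of r outside X the fibers of f and w are coprime, so the fiber of b,
   of degree less than m, vanishes. *)
Lemma Bezout_strip_roots q r a b : r != 0 -> r%:P = a * f + b * w ->
  bideg_lt m q b ->
  exists r' a' b', [/\ r' != 0, (size r' <= size r)%N,
    forall x, root r' x -> x \in X, r'%:P = a' * f + b' * w & bideg_lt m q b'].
Proof.
have [k] := ubnP (size r); elim: k r a b => // k IHk r a b; rewrite ltnS => rk r0 rE bb.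
have [[x [rx xX]]|noroot] := pselect (exists x, root r x /\ x \notin X); last first.
  exists r, a, b; split=> // x rx; apply/negPn/negP => xX.
  by apply: noroot; exists x.
have [r1 r1E] := factor_theorem _ _ rx; rewrite mulrC in r1E.
have fibE := congr1 (map_poly (horner_eval x)) rE.
rewrite rmorphD !rmorphM /= map_polyC /= /horner_eval (eqP rx) in fibE.
have f0 : fiber x f != 0 by rewrite -size_poly_gt0 size_fiber.
have b0 : fiber x b = 0.
  have : fiber x f %| fiber x b.
    rewrite -(Gauss_dvdpl _ (coprimep_fiber xX)).
    move/esym/eqP: fibE; rewrite addrC addr_eq0 => /eqP ->.
    by rewrite -mulNr dvdp_mull.
  move=> fb; apply/eqP/negPn/negP => /dvdp_leq/(_ fb).
  by rewrite size_fiber // leqNgt ltnS (leq_trans (size_poly _ _) bb.1).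
have a0 : fiber x a = 0.
  apply: (mulIf f0); rewrite mul0r; apply/eqP.
  by move: fibE; rewrite b0 mul0r addr0 => <-; rewrite polyC0.
have [a1 aE] := fiber_eq0 a0; have [b1 bE] := fiber_eq0 b0.
have X0 : 'X - x%:P != 0 by rewrite polyXsubC_eq0.
have r10 : r1 != 0 by move: r0; rewrite r1E mulf_eq0 negb_or => /andP[].
have sr1 : size r = (size r1).+1.
  by rewrite r1E size_mul // size_XsubC.
have [||||r' [a' [b' [? sr' ? ? ?]]]] := IHk r1 a1 b1.
- by rewrite -sr1.
- by [].
- by apply: (polyC_mulI X0); rewrite mulrDr !mulrA -aE -bE -rE r1E polyCM.
- move: bb; rewrite bE => -[sb cb]; split=> [|i].
    by move: sb; rewrite mul_polyC size_scale.
  apply: leq_trans (cb i); rewrite coefCM.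
  have [->|b1i] := eqVneq b1`_i 0; first by rewrite size_poly0.
  by rewrite size_mul // size_XsubC.
by exists r', a', b'; split=> //; rewrite (leq_trans sr') // sr1.
Qed.

End CommonZeros.

Lemma dvdp_prod_XsubC_exp (X : seq K) k r : r != 0 -> (size r <= k.+1)%N ->
  (forall x, root r x -> x \in X) -> r %| (\prod_(x <- X) ('X - x%:P)) ^+ k.
Proof.
elim: k r => [|k IHk] r r0 sr rX.
  by rewrite expr0 dvdp1 eqn_leq sr size_poly_gt0.
have [sr1|/closed_rootP[x rx]] := eqVneq (size r) 1.
  have r1 : r %= 1 by rewrite -size_poly_eq1 sr1.
  by rewrite (eqp_dvdl _ r1) dvd1p.
have [r1 r1E] := factor_theorem _ _ rx.
have r10 : r1 != 0 by move: r0; rewrite r1E mulf_eq0 negb_or => /andP[].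
rewrite r1E exprSr dvdp_mul //.
  apply: IHk => // [|y r1y].
    by move: sr; rewrite r1E size_mul ?polyXsubC_eq0 // size_XsubC addn2.
  by apply: rX; rewrite r1E rootM r1y.
by rewrite dvdp_XsubCl root_prod_XsubC rX.
Qed.

Section Family.
Variables (f : {poly {poly K}}) (m n : nat).
Hypothesis f_irr : forall a b, f = a * b ->
  a \is a GRing.unit \/ b \is a GRing.unit.
Hypothesis m_gt0 : (0 < m)%N.
Hypothesis size_f : size f = m.+1.
Hypothesis bideg_f : bideg_lt m.+1 n f.

(** Otherwise the polynomial [r] of a bounded Bezout identity would have more roots [t j] than its
    size allows. So values at these points determine [w] modulo [f]. *)
Lemma divides_of_zeros l (t y : 'I_((m + l) * n).+1 -> K) w :
  injective t -> (forall j, f.[(y j)%:P].[t j] = 0) ->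
  bideg_lt l n w -> (forall j, w.[(y j)%:P].[t j] = 0) -> divides f w.
Proof.
move=> t_inj fty bw wty; apply: contrapT => ndiv.
have [r [a [b [r0 sr _ rE]]]] :=
  bounded_Bezout f_irr m_gt0 size_f bideg_f bw ndiv.
have: all (root r) (codom t).
  apply/allP => _ /codomP[j ->]; rewrite rootE.
  have := congr1 (fun p : {poly {poly K}} => p.[(y j)%:P].[t j]) rE.
  by rewrite !hornerE fty wty !mulr0 addr0 => ->.
move=> /(max_poly_roots r0); rewrite map_inj_uniq ?enum_uniq // => /(_ isT).
by rewrite size_codom card_ord ltnNge sr.
Qed.

(** The right-hand side of the stripped Bezout identity has roots in [X] only and bounded size, so
    it divides a power of the product of the ['X - x%:P] whose exponent does not depend on [w]. *)
Lemma uniform_cofactor l (X : seq K) :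
  (forall x, (lead_coef f).[x] = 0 -> x \in X) ->
  exists (c : {poly K}) q, (forall x, x \notin X -> c.[x] != 0) /\
    forall w, bideg_lt l n w -> ~ divides f w ->
      (forall x y, f.[y%:P].[x] = 0 -> w.[y%:P].[x] = 0 -> x \in X) ->
    exists b, bideg_lt m q b /\ divides f (c%:P - b * w).
Proof.
move=> lead_f; pose D := ((m + l) * n).+1.
pose c := (\prod_(x <- X) ('X - x%:P)) ^+ D; exists c, (size c + D)%N; split.
  by move=> x xX; rewrite horner_exp expf_neq0 // -rootE root_prod_XsubC.
move=> w bw ndiv fw_zeros.
have [r [a [b [r0 sr bb rE]]]] :=
  bounded_Bezout f_irr m_gt0 size_f bideg_f bw ndiv.
have [r' [a' [b' [r'0 sr' r'X r'E bb']]]] :=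
  Bezout_strip_roots size_f lead_f fw_zeros r0 rE bb.
have /dvdpP[e cE] : r' %| c.
  by apply: dvdp_prod_XsubC_exp; rewrite // (leq_trans sr') // (leq_trans sr).
have c0 : c != 0.
  rewrite expf_neq0 // -size_poly_gt0 size_prod_XsubC //.
exists (e%:P * b'); split; last first.
  by exists (e%:P * a'); rewrite cE polyCM r'E; ring.
have se : (size e <= size c)%N.
  by rewrite dvdp_leq // cE dvdp_mulr.
exact: bideg_ltW (leqnn _) (leqnn _) (bideg_ltM (bideg_ltC se) bb').
Qed.

End Family.
End Bivariate.

(** * Finiteness of the classes modulo f *)

Section Evaluation.
Variables (K : closedFieldType) (c p q : nat) (t y : 'I_c -> K).

Definition eval_row (u : 'rV[K]_(p * q)) : 'rV[K]_c :=
  \row_j (poly_of_mx (vec_mx u)).[(y j)%:P].[t j].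

Lemma eval_row_linear : linear eval_row.
Proof.
move=> x u v; apply/rowP => j; rewrite !mxE linearP /= poly_of_mx_linear.
by rewrite !hornerE.
Qed.

HB.instance Definition _ := GRing.isLinear.Build K 'rV[K]_(p * q) 'rV[K]_c _
  eval_row eval_row_linear.

Definition eval_mx : 'M[K]_(p * q, c) := lin1_mx eval_row.

Lemma eval_mxE (u : 'rV[K]_(p * q)) j :
  (u *m eval_mx) 0 j = (poly_of_mx (vec_mx u)).[(y j)%:P].[t j].
Proof. by rewrite mul_rV_lin1 mxE. Qed.

Lemma eval_mx_poly (w : {poly {poly K}}) j : bideg_lt p q w ->
  (mxvec (mx_of_poly p q w) *m eval_mx) 0 j = w.[(y j)%:P].[t j].
Proof. by move=> bw; rewrite eval_mxE mxvecK mx_of_polyK. Qed.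

End Evaluation.

Lemma fresh_family (K : numClosedFieldType) (X : seq K) c :
  exists t : 'I_c -> K, injective t /\ forall j, t j \notin X.
Proof.
(* [S] dominates every element of [X], so the points [S + j.+1%:R] avoid [X]. *)
pose S := \sum_(x <- X) `|x|.
have S0 : 0 <= S by apply: sumr_ge0 => x _; exact: normr_ge0.
exists (fun j => S + j.+1%:R); split=> [i j /addrI/eqP|j].
  by rewrite eqr_nat eqSS => /eqP/val_inj.
apply/negP => tX; have : `|S + j.+1%:R| <= S.
  rewrite {2}/S (big_rem _ tX) /= lerDl; apply: sumr_ge0 => x _.
  exact: normr_ge0.
by rewrite ger0_norm ?addr_ge0 // gerDl lern0.
Qed.

Section Classes.
Variables (K : numClosedFieldType) (f : {poly {poly K}}) (m n l : nat).
Variable X : seq K.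
Hypothesis f_irr : forall a b, f = a * b ->
  a \is a GRing.unit \/ b \is a GRing.unit.
Hypothesis m_gt0 : (0 < m)%N.
Hypothesis size_f : size f = m.+1.
Hypothesis bideg_f : bideg_lt m.+1 n f.
Hypothesis lead_f : forall x, (lead_coef f).[x] = 0 -> x \in X.

Definition zeros_over (w : {poly {poly K}}) := forall x y,
  f.[y%:P].[x] = 0 -> w.[y%:P].[x] = 0 -> x \in X.

(* Each w divides, modulo f, the same polynomial c in x, with a cofactor of bounded
   degree; all this is read off from the values at finitely many points of the
   curve f = 0. *)
Lemma zeros_over_finite_classes :
  exists N (col : {poly {poly K}} -> 'I_N), forall w w',
    bideg_lt l n w -> bideg_lt l n w' -> zeros_over w -> zeros_over w' ->
    col w = col w' -> exists z : K, divides f (w - z%:P%:P * w').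
Proof.
have [c [q [cX cofactor]]] := uniform_cofactor f_irr m_gt0 size_f bideg_f l lead_f.
(* Enough points to test divisibility by [f] in bidegree [(l + m, n + q)], that of the product of a
   [w] and a cofactor. *)
pose D := ((m + (l + m)) * (n + q))%N.
have bideg_f' : bideg_lt m.+1 (n + q) f by apply: bideg_ltW bideg_f; rewrite ?leq_addr.
have [t [t_inj tX]] := fresh_family X D.+1.
have /fin_all_exists[y fty] j : exists y : K, f.[y%:P].[t j] = 0.
  have /closed_rootP[y] : size (map_poly (horner_eval (t j)) f) != 1.
    by rewrite (size_fiber size_f lead_f (tX j)) eqSS -lt0n.
  by rewrite rootE horner_fiber => /eqP; exists y.
have zero_divides w j : divides f w -> w.[(y j)%:P].[t j] = 0.
  by move=> [k ->]; rewrite !hornerM fty mul0r.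
have divides_zero w : bideg_lt (l + m) (n + q) w ->
    (forall j, w.[(y j)%:P].[t j] = 0) -> divides f w.
  exact: (divides_of_zeros f_irr m_gt0 size_f bideg_f' t_inj fty).
have zeros_neq0 w j : zeros_over w -> w.[(y j)%:P].[t j] != 0.
  by move=> zw; apply: contraNneq (tX j) => /zw; apply; exact: fty.
pose M : 'M[K]_(l * n, D.+1) := eval_mx _ _ t y.
pose N : 'M[K]_(m * q, D.+1) := eval_mx _ _ t y.
(* This is primality of [f]: a product vanishing at all the sample points is divisible by [f], so
   one of its factors is. *)
have nondeg (u : 'rV_(l * n)) (v : 'rV_(m * q)) :
    (forall j, (u *m M) 0 j * (v *m N) 0 j = 0) -> u *m M = 0 \/ v *m N = 0.
  move=> uv0; pose g := poly_of_mx (vec_mx u); pose h := poly_of_mx (vec_mx v).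
  have bgh : bideg_lt (l + m) (n + q) (g * h).
    by apply: bideg_ltW (leq_pred _) (leqnn _) (bideg_ltM _ _);
      exact: bideg_poly_of_mx.
  have /(irr_prime f_irr) : divides f (g * h).
    by apply: divides_zero => // j; rewrite !hornerM -!eval_mxE uv0.
  rewrite size_f ltnS => /(_ m_gt0)[] fd; [left | right];
    by apply/rowP => j; rewrite eval_mxE zero_divides // mxE.
have [s Hs] := row_space_units_finite (nu := fun j => c.[t j]) nondeg (cX _ (tX ord0)).
pose ev w := mxvec (mx_of_poly l n w) *m M.
(* The value 1 at the first point selects one representative per line of scalars; the position of
   [u w] in [s] is the class of [w]. *)
pose u w := (ev w 0 ord0)^-1 *: ev w.
exists (size s).+1, (fun w => inord (index (u w) s)) => w w' bw bw' zw zw'.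
have evE v : bideg_lt l n v -> forall j, ev v 0 j = v.[(y j)%:P].[t j].
  by move=> bv j; rewrite /ev eval_mx_poly.
have scaleE (z : K) (A : 'rV[K]_D.+1) j : (z *: A) 0 j = z * A 0 j.
  by rewrite mxE.
have u_s v : bideg_lt l n v -> zeros_over v -> u v \in s.
  move=> bv zv; have ev0 : ev v 0 ord0 != 0 by rewrite evE // zeros_neq0.
  have [|b [bb fb]] := cofactor v bv _ zv.
    by move=> /(zero_divides _ ord0)/eqP; rewrite (negbTE (zeros_neq0 _ _ zv)).
  have uE : u v = ((ev v 0 ord0)^-1 *: mxvec (mx_of_poly l n v)) *m M.
    by rewrite -scalemxAl.
  rewrite uE; apply: (Hs _ (ev v 0 ord0 *: mxvec (mx_of_poly m q b))).
    move=> j; rewrite -!scalemxAl !scaleE mulrACA mulVf // mul1r.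
    rewrite -/(ev v) evE // eval_mx_poly //.
    apply/esym/eqP; rewrite -subr_eq0 [v.[_].[_] * _]mulrC.
    by have := zero_divides _ j fb; rewrite !hornerE => /eqP.
  by rewrite -uE scaleE mulVf.
move=> /(congr1 val); rewrite /= !inordK ?ltnS ?index_size // => eq_ind.
have uu' : u w = u w'.
  by rewrite -(nth_index 0 (u_s w bw zw)) eq_ind nth_index // u_s.
exists (ev w 0 ord0 / ev w' 0 ord0); apply: divides_zero.
  apply: bideg_ltW (leq_addr _ _) (leq_addr _ _) _; apply: bideg_lt_sub => //.
  split=> [|i]; first by rewrite (leq_trans _ bw'.1) // mul_polyC size_scale_leq.
  by rewrite coefCM (leq_trans _ (bw'.2 i)) // mul_polyC size_scale_leq.
move=> j; have := congr1 (fun A : 'rV_(D.+1) => A 0 j) uu'.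
rewrite !scaleE !hornerE -!evE //.
have ew0 : ev w 0 ord0 != 0 by rewrite evE // zeros_neq0.
move=> /(congr1 ( *%R (ev w 0 ord0))); rewrite mulVKf // mulrA => ->.
by rewrite subrr.
Qed.

End Classes.

(** * Dehomogenization *)

Section Dehomogenization.
Variables (K : closedFieldType) (o x h : 'I_3).
Hypothesis ox : o != x.
Hypothesis oh : o != h.
Hypothesis xh : x != h.
Hypothesis oxh : forall i, [|| i == o, i == x | i == h].
Implicit Types (F G H A B : {mpoly K[3]}) (m : 'X_{1..3}) (z : K).

Lemma big_oxh (T : Type) (idx : T) (op : Monoid.com_law idx) (E : 'I_3 -> T) :
  \big[op/idx]_i E i = op (E o) (op (E x) (E h)).
Proof.
rewrite (bigD1 o) //= (bigD1 x) 1?eq_sym //= (bigD1 h) /=; last first.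
  by rewrite eq_sym oh eq_sym xh.
rewrite big1 ?Monoid.mulm1 // => i /andP[/andP[io ix] ih].
by have := oxh i; rewrite (negbTE io) (negbTE ix) (negbTE ih).
Qed.

Lemma mnm_oxhP m m' : m o = m' o -> m x = m' x -> m h = m' h -> m = m'.
Proof. by move=> mo mx mh; apply/mnmP => i; case/or3P: (oxh i) => /eqP ->. Qed.

Lemma mdeg_oxh m : mdeg m = (m o + (m x + m h))%N.
Proof. by rewrite mdegE big_oxh. Qed.

Definition dehom_var z (i : 'I_3) : {poly {poly K}} :=
  if i == o then 'X else if i == x then 'X%:P else z%:P%:P.

(* Setting the variable h to z makes a form a polynomial in x (inner variable)
   and o (outer variable): z = 1 is dehomogenization, and z = 0 restricts to the
   line at infinity. *)
Definition dehom z : {mpoly K[3]} -> {poly {poly K}} :=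
  mmap (polyC \o polyC) (dehom_var z).

HB.instance Definition _ z := GRing.RMorphism.on (dehom z).

Lemma dehomX z m :
  dehom z 'X_[m] = (z ^+ m h *: 'X^(m x))%:P * 'X^(m o).
Proof.
rewrite /dehom mmapX /mmap1 big_oxh /dehom_var eqxx.
rewrite [x == o]eq_sym (negbTE ox) eqxx [h == o]eq_sym (negbTE oh).
rewrite [h == x]eq_sym (negbTE xh) mulrC -!rmorphXn /= -rmorphM /=.
by congr (_ * _%:P); rewrite mulrC mul_polyC.
Qed.

Lemma dehomZ z c F : dehom z (c *: F) = c%:P%:P * dehom z F.
Proof. by rewrite /dehom mmapZ. Qed.

Lemma dehom_subZ z c F G :
  dehom z (F - c *: G) = dehom z F - c%:P%:P * dehom z G.
Proof. by rewrite rmorphB /= dehomZ. Qed.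

Lemma dehomE z F : dehom z F =
  \sum_(m <- msupp F) ((F@_m * z ^+ m h) *: 'X^(m x))%:P * 'X^(m o).
Proof.
rewrite {1}[F]mpolyE rmorph_sum /=; apply: eq_bigr => m _.
rewrite dehomZ dehomX mulrA -polyCM.
by congr (_%:P * _); rewrite mul_polyC scalerA.
Qed.

Lemma coef_dehom z F i j : (dehom z F)`_i`_j =
  \sum_(m <- msupp F | (m o == i) && (m x == j)) F@_m * z ^+ m h.
Proof.
rewrite dehomE coef_sum coef_sum [RHS]big_mkcond; apply: eq_bigr => m _.
rewrite coefCM coefXn [i == _]eq_sym; case: (m o == i) => /=.
  by rewrite mulr1 coefZ coefXn [j == _]eq_sym; case: eqP; rewrite ?mulr1 ?mulr0.
by rewrite mulr0 coef0.
Qed.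

(** Serves twice: for [z = 1] on forms, where the degree fixes the exponent of [h], and for [z = 0],
    where terms containing [h] vanish. *)
Lemma coef_dehom_unique z F m :
  (forall m', m' \in msupp F -> m' o = m o -> m' x = m x -> m' != m ->
     z ^+ m' h = 0) ->
  (dehom z F)`_(m o)`_(m x) = F@_m * z ^+ m h.
Proof.
move=> uniq_m; rewrite coef_dehom.
have [mF|mF] := boolP (m \in msupp F); last first.
  rewrite (memN_msupp_eq0 mF) mul0r big_seq_cond big1 // => m'.
  move=> /andP[m'F /andP[/eqP m'o /eqP m'x]]; rewrite (uniq_m m') ?mulr0 //.
  by apply: contraNneq mF => <-.
rewrite big_mkcond (bigD1_seq m) ?msupp_uniq //= !eqxx /=.
rewrite big_seq_cond big1 ?addr0 // => m' /andP[m'F m'm].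
by case: ifP => // /andP[/eqP m'o /eqP m'x]; rewrite (uniq_m m') ?mulr0.
Qed.

Lemma coef_dehom_homog d F m : F \is d.-homog -> mdeg m = d ->
  (dehom 1 F)`_(m o)`_(m x) = F@_m.
Proof.
move=> /dhomogP Fd md; rewrite coef_dehom_unique ?expr1n ?mulr1 //.
move=> m' /Fd/= m'd m'o m'x /eqP[]; apply: mnm_oxhP => //.
by move: m'd; rewrite /= -md !mdeg_oxh m'o m'x => /addnI/addnI.
Qed.

Lemma dehom_inj d F G : F \is d.-homog -> G \is d.-homog ->
  dehom 1 F = dehom 1 G -> F = G.
Proof.
move=> Fd Gd FG; apply/mpolyP => m; have [md|md] := eqVneq (mdeg m) d.
  by rewrite -(coef_dehom_homog Fd md) FG (coef_dehom_homog Gd md).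
by rewrite (dhomog_nemf_coeff Fd md) (dhomog_nemf_coeff Gd md).
Qed.

(** Homogenization: monomials are padded with the variable [h] up to degree [d], which bounds the
    total degree of [p]. *)
Lemma dehom_surj p : exists d F, F \is d.-homog /\ dehom 1 F = p.
Proof.
have [q [_ pq]] := bideg_lt_exists p; pose d := (size p + q)%N.
pose mon i j := [multinom (if k == o then i else if k == x then j else
  (d - i - j)%N) | k < 3].
have mono i j : mon i j o = i by rewrite mnmE eqxx.
have monx i j : mon i j x = j by rewrite mnmE eq_sym (negbTE ox) eqxx.
have monh i j : mon i j h = (d - i - j)%N.
  by rewrite mnmE eq_sym (negbTE oh) eq_sym (negbTE xh).
exists d, (\sum_(i < size p) \sum_(j < q) p`_i`_j *: 'X_[mon i j]); split.
  apply: rpred_sum => i _; apply: rpred_sum => j _; apply: rpredZ.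
  rewrite dhomogX /= mdeg_oxh mono monx monh addnA -subnDA addnC subnK //.
  by rewrite leq_add // ltnW.
rewrite rmorph_sum /= -[RHS]coefK poly_def; apply: eq_bigr => i _.
rewrite rmorph_sum /= -mul_polyC.
have piE : p`_i = \sum_(j < q) p`_i`_j *: 'X^j.
  rewrite -poly_def; apply/polyP => j; rewrite coef_poly.
  by case: ltnP => // qj; rewrite nth_default // (leq_trans (pq i)).
rewrite [in RHS]piE rmorph_sum mulr_suml; apply: eq_bigr => j _ /=.
rewrite dehomZ dehomX mono monx monh expr1n scale1r mulrA -polyCM.
by congr (_%:P * _); rewrite mul_polyC.
Qed.

(** Makes ['X_h] prime: it generates the kernel of a morphism into a domain. *)
Lemma dehom0_eq0 F : dehom 0 F = 0 -> exists G, F = 'X_h * G.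
Proof.
move=> F0; have Fh m : m \in msupp F -> m h != 0%N.
  rewrite mcoeff_msupp; apply: contraNneq => mh.
  have := coef_dehom_unique (z := 0) (F := F) (m := m).
  rewrite F0 !coef0 mh mulr1 => <- // m' _ m'o m'x m'm.
  rewrite expr0n; case: eqP => // m'h; case/eqP: m'm.
  by apply: mnm_oxhP => //; rewrite m'h.
exists (\sum_(m <- msupp F) F@_m *: 'X_[m - U_(h)]).
rewrite {1}[F]mpolyE mulr_sumr big_seq [RHS]big_seq; apply: eq_bigr => m mF.
rewrite -scalerAr -mpolyXD addmC submK //.
by rewrite lep1mP Fh.
Qed.

Let w : {mpoly K[3]} := 'X_h.

Let dehom_w : dehom 1 w = 1.
Proof.
by rewrite dehomX !mnm1E eqxx [h == x]eq_sym [h == o]eq_sym (negbTE xh) (negbTE oh)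
           expr1n scale1r !expr0 mulr1.
Qed.

Let dehom0_w : dehom 0 w = 0.
Proof. by rewrite dehomX !mnm1E eqxx expr1 scale0r polyC0 mul0r. Qed.

Let w_neq0 : w != 0.
Proof.
by apply: contra_eqN dehom_w => /eqP ->; rewrite rmorph0 eq_sym oner_eq0.
Qed.

Lemma split_Xh_exp k A B F : A * B = 'X_h ^+ k * F ->
  exists i j A' B', [/\ A = 'X_h ^+ i * A', B = 'X_h ^+ j * B' & F = A' * B'].
Proof.
elim: k A B => [|k IHk] A B.
  by rewrite mul1r => <-; exists 0%N, 0%N, A, B; rewrite !mul1r.
move=> AB; have := congr1 (dehom 0) AB; rewrite exprS !rmorphM /= dehom0_w !mul0r.
move=> /eqP; rewrite mulf_eq0 => /orP[]/eqP/dehom0_eq0[G GE].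
  have /IHk[i [j [A' [B' [GA BB FE]]]]] : G * B = 'X_h ^+ k * F.
    by apply: (mulfI w_neq0); rewrite mulrA -GE AB exprS mulrA.
  by exists i.+1, j, A', B'; split=> //; rewrite GE GA exprS mulrA.
have /IHk[i [j [A' [B' [AA GB FE]]]]] : A * G = 'X_h ^+ k * F.
  by apply: (mulfI w_neq0); rewrite mulrCA -GE AB exprS mulrA.
by exists i, j.+1, A', B'; split=> //; rewrite GE GB exprS mulrA.
Qed.

Lemma dehom_Xh_exp k F : dehom 1 ('X_h ^+ k * F) = dehom 1 F.
Proof. by rewrite rmorphM rmorphXn /= dehom_w expr1n mul1r. Qed.

Lemma Xh_homog k : ('X_h ^+ k : {mpoly K[3]}) \is k.-homog.
Proof.
have X1 : ('X_h : {mpoly K[3]}) \is 1.-homog by rewrite dhomogX /= mdeg1.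
by have := dhomogMn k X1; rewrite mul1n.
Qed.

Section Irreducible.
Variables (d : nat) (F : {mpoly K[3]}).
Hypothesis F_homog : F \is d.-homog.
Hypothesis F_irr : forall A B, F = A * B ->
  A \is a GRing.unit \/ B \is a GRing.unit.

(** Homogenizing the factors gives a factorization of [F] up to powers of ['X_h], and [dehom 1]
    sends these powers to 1. *)
Lemma dehom_irr a b : dehom 1 F = a * b ->
  a \is a GRing.unit \/ b \is a GRing.unit.
Proof.
have [da [A [Ad <-]]] := dehom_surj a; have [db [B [Bd <-]]] := dehom_surj b.
(* The powers of ['X_h] bring both sides to the degree [da + d + db], where [dehom 1] is
   injective. *)
move=> FAB; have AB : A * ('X_h ^+ d * B) = 'X_h ^+ (da + db) * F.
  apply: (@dehom_inj (da + (d + db))).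
  - by rewrite !dhomogM ?Xh_homog.
  - by rewrite addnCA [(d + _)%N]addnC; apply: dhomogM (Xh_homog _) F_homog.
  - by rewrite dehom_Xh_exp rmorphM /= dehom_Xh_exp.
have [i [j [A' [B' [AA BB FE]]]]] := split_Xh_exp AB.
rewrite -(dehom_Xh_exp d B) AA BB !dehom_Xh_exp.
by have [u|u] := F_irr FE; [left|right]; apply: rmorph_unit.
Qed.

Hypothesis F_deg : (1 < size (dehom 1 F))%N.

(** Homogenizing gives [F * Q = 'X_h ^+ dq * G]. Since ['X_h] cannot divide [F], whose
    dehomogenization is not a unit, the power comes off [Q], and equality of degrees makes the
    remaining factor constant. *)
Lemma divides_dehom_scalar G : G \is d.-homog ->
  divides (dehom 1 F) (dehom 1 G) -> exists c, G = c *: F.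
Proof.
move=> Gd [q]; have [dq [Q [Qd <-]]] := dehom_surj q => GFQ.
have FQ : F * Q = 'X_h ^+ dq * G.
  apply: (@dehom_inj (d + dq)).
  - exact: dhomogM.
  - by rewrite addnC dhomogM ?Xh_homog.
  - by rewrite dehom_Xh_exp rmorphM.
have [[|i] [j [F' [Q' [FF QQ GE]]]]] := split_Xh_exp FQ; last first.
  have FXF : F = 'X_h * ('X_h ^+ i * F') by rewrite mulrA -exprS.
  have [/(rmorph_unit (dehom 0))|] := F_irr FXF; first by rewrite /= dehom0_w unitr0.
  move=> /(rmorph_unit (dehom 1)).
  rewrite /= dehom_Xh_exp poly_unitE => /andP[/eqP sF' _].
  by move: F_deg; rewrite FF dehom_Xh_exp sF'.
rewrite mul1r in FF; rewrite -FF in GE.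
have [G0|G0] := eqVneq G 0; first by exists 0; rewrite scale0r.
have [F0 Q0] : F != 0 /\ Q' != 0.
  by apply/andP; rewrite -negb_or -mulf_eq0 -GE.
exists (Q'@_0%MM); rewrite GE mulrC -mul_mpolyC -msize1_polyC //.
have dG := dhomog_uniq G0 Gd (dhomog_msize Gd).
have dF := dhomog_uniq F0 F_homog (dhomog_msize F_homog).
move: dG; rewrite GE msizeM // {1}dF (mpolySpred _ F0) (mpolySpred _ Q0) /=.
by rewrite addnS -[LHS]addn0 => /addnI <-.
Qed.

End Irreducible.

Lemma horner_dehom F (v : 'I_3 -> K) : v h = 1 ->
  (dehom 1 F).[(v o)%:P].[v x] = F.@[v].
Proof.
move=> vh; rewrite dehomE mevalE !horner_sum; apply: eq_bigr => m _.
by rewrite big_oxh vh !hornerE !expr1n /= !mulr1 mulrAC.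
Qed.

Lemma size_dehom d F m : F \is d.-homog -> m \in msupp F -> (0 < m o)%N ->
  (1 < size (dehom 1 F))%N.
Proof.
move=> Fd mF mo; rewrite ltnNge; apply/negP => sF.
move: (mF); rewrite mcoeff_msupp -(coef_dehom_homog Fd (dhomog_mf Fd mF)).
by rewrite (nth_default 0 (leq_trans sF mo)) coef0 eqxx.
Qed.

End Dehomogenization.

(** * Curves in the projective plane *)

Lemma bideg_dehom (K : closedFieldType) (o x h : 'I_3) d (F : {mpoly K[3]}) :
  o != x -> o != h -> x != h -> (forall i, [|| i == o, i == x | i == h]) ->
  F \is d.-homog -> bideg_lt d.+1 d.+1 (dehom o x 1 F).
Proof.
move=> ox oh xh oxh /dhomogP Fd.
have le_d m i : m \in msupp F -> (m i <= d)%N.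
  by move=> /Fd /= <-; rewrite mdegE (bigD1 i) //= leq_addr.
have coef0 i j : (d < i)%N || (d < j)%N -> (dehom o x 1 F)`_i`_j = 0.
  move=> dij; rewrite (coef_dehom ox oh xh oxh) big_seq_cond big_pred0 // => m.
  apply/negP => /and3P[mF /eqP mo /eqP mx].
  by move: dij; rewrite -mo -mx !ltnNge !le_d.
split=> [|i]; apply/leq_sizeP => j dj; last by rewrite coef0 ?dj ?orbT.
by apply/polyP => k; rewrite coef0 ?dj // polyseq0 nth_nil.
Qed.

Lemma third_variables (o : 'I_3) : exists x h : 'I_3,
  [/\ o != x, o != h, x != h & forall i, [|| i == o, i == x | i == h]].
Proof.
pose a : 'I_3 := inord 0; pose b : 'I_3 := inord 1; pose c : 'I_3 := inord 2.
have abc i : [|| i == a, i == b | i == c].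
  by rewrite -!val_eqE /= !inordK //; case: i => [[|[|[|]]]].
have [ab ac bc] : [/\ a != b, a != c & b != c].
  by rewrite -!val_eqE /= !inordK.
have [ba ca cb] : [/\ b != a, c != a & c != b] by split; rewrite eq_sym.
case/or3P: (abc o) => /eqP ->; [exists b, c|exists a, c|exists a, b]; split=> // i;
  by case/or3P: (abc i) => ->; rewrite ?orbT.
Qed.

(** Supplies the outer variable: one that occurs in [F], so that [dehom 1 F] has positive degree in
    it. *)
Lemma mpoly_irr_variable (K : fieldType) k (F : {mpoly K[k]}) :
  F != 0 -> F \isn't a GRing.unit ->
  exists m i, m \in msupp F /\ (0 < m i)%N.
Proof.
move=> F0 Fu; have [m0|m0] := eqVneq (mlead F) 0%MM; last first.
  exists (mlead F); have [i mi|mlead0] := pickP (fun i => mlead F i != 0%N).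
    by exists i; rewrite mlead_supp // lt0n.
  case/eqP: m0; apply/mnmP => i; rewrite mnm0E; apply/eqP.
  by have := mlead0 i; case: eqP.
case/negP: Fu; have sF : msize F = 1 by rewrite -mlead_deg // m0 mdeg0.
rewrite (msize1_polyC (eq_leq sF)); apply: (rmorph_unit (@mpolyC k K)).
rewrite unitfE; apply: contra_neq F0 => F00.
by rewrite (msize1_polyC (eq_leq sF)) F00 mpolyC0.
Qed.

Lemma meval_homog_scale (K : fieldType) k d (F : {mpoly K[k]}) (z : K) (v : 'I_k -> K) :
  F \is d.-homog -> F.@[fun i => z * v i] = z ^+ d * F.@[v].
Proof.
move=> /dhomogP Fd; rewrite !mevalE mulr_sumr big_seq [RHS]big_seq.
apply: eq_bigr => m /Fd /= <-; rewrite mdegE mulrCA; congr (_ * _).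
rewrite -prodrXr -big_split /=; apply: eq_bigr => i _.
by rewrite exprMn.
Qed.

Section Points.
Variable R : realType.
Local Notation K := (R[i]).

Lemma point_of_coords (v : 'rV[K]_3) : v != 0 -> \dim <[v]>%VS == 1%N.
Proof. by move=> v0; rewrite dim_vline v0. Qed.

Lemma zero_locus_coords d (F : {mpoly K[3]}) (p : P2 R) (v : 'rV[K]_3) :
  F \is d.-homog -> sval p = <[v]>%VS -> F.@[fun i => v 0 i] = 0 ->
  zero_locus F p.
Proof.
move=> Fd pv Fv z [z0 pz]; have /vlineP[c zE] : z \in <[v]>%VS.
  by rewrite -pv pz memv_line.
rewrite -[LHS](@meval_eq _ _ (fun i => c * v 0 i)); last first.
  by move=> i; rewrite zE mxE.
by rewrite (meval_homog_scale c _ Fd) Fv mulr0.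
Qed.

(** The quotient does not depend on the representative picked. On the line at infinity it is 0 by
    convention, which merely adds an excluded abscissa. *)
Definition affine_coord (x h : 'I_3) (p : P2 R) : K :=
  vpick (sval p) 0 x / vpick (sval p) 0 h.

Lemma affine_coordE x h (p : P2 R) (v : 'rV[K]_3) :
  sval p = <[v]>%VS -> v != 0 -> v 0 h = 1 -> affine_coord x h p = v 0 x.
Proof.
move=> pv v0 vh; rewrite /affine_coord pv.
have /vlineP[c zE] : vpick <[v]>%VS \in <[v]>%VS by exact: memv_pick.
have : vpick <[v]>%VS != 0 by rewrite vpick0 -dimv_eq0 dim_vline v0.
rewrite zE !mxE vh mulr1 scaler_eq0 negb_or => /andP[c0 _].
by rewrite mulrAC mulfV ?mul1r.
Qed.

End Points.

(** * From finitely many singularities to a pencil *)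

Section MainTheorem.
Variable R : realType.
Local Notation K := (R[i]).

(** The common affine zero is a point of two different curves of the collection; this turns
    finiteness of [Sing CC] into finiteness of the abscissas. *)
Lemma common_zeros_Sing (CC : set (set (P2 R))) d (o x h : 'I_3) (C0 C : set (P2 R))
    (F G : {mpoly K[3]}) (s t : K) :
  o != x -> o != h -> x != h -> (forall i, [|| i == o, i == x | i == h]) ->
  CC C0 -> CC C -> C <> C0 ->
  F \is d.-homog -> C0 = zero_locus F -> G \is d.-homog -> C = zero_locus G ->
  (dehom o x 1 F).[s%:P].[t] = 0 -> (dehom o x 1 G).[s%:P].[t] = 0 ->
  exists2 p, Sing CC p & affine_coord x h p = t.
Proof.
move=> ox oh xh oxh CC0 CCC neqC Fd C0E Gd CE.
pose v : 'rV[K]_3 := \row_i if i == o then s else if i == x then t else 1.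
have vo : v 0 o = s by rewrite mxE eqxx.
have vx : v 0 x = t by rewrite mxE eq_sym (negbTE ox) eqxx.
have vh : v 0 h = 1 by rewrite mxE eq_sym (negbTE oh) eq_sym (negbTE xh).
have v0 : v != 0.
  by apply: contra_eq_neq vh => ->; rewrite mxE eq_sym oner_eq0.
rewrite -vo -vx !(horner_dehom ox oh xh oxh _ (v := fun i => v 0 i) vh) => Fv Gv.
exists (exist _ <[v]>%VS (point_of_coords v0)); last exact: affine_coordE.
right; exists C, C0; split=> //; split.
- by rewrite CE; apply: (zero_locus_coords (v := v) Gd).
- by rewrite C0E; apply: (zero_locus_coords (v := v) Fd).
Qed.

End MainTheorem.

Local Open Scope classical_set_scope.
Local Open Scope ring_scope.

Lemma infinite_set_nonempty (T : Type) (A : set T) : infinite_set A -> A !=set0.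
Proof.
by move=> Ainf; apply/set0P/eqP => A0; apply: Ainf; rewrite A0; exact: finite_set0.
Qed.

Theorem proposition3p1 (R : realType) (d : nat) (CC : set (set (P2 R)))
    (CC_infinite : infinite_set CC)
    (CC_curves : forall C, CC C -> irreducible_curve d C)
    (Sing_finite : finite_set (Sing CC)) :
  exists (e : nat) (F G : {mpoly R[i][3]}),
    [/\ F \is e.-homog, G \is e.-homog, nonconstant_quotient F G &
        infinite_set [set C | CC C /\ level_set F G C]].
Proof.
have /choice[eqn eqnP] : forall C, exists F, CC C -> irreducible_equation d F C.
  move=> C; have [CCC|nCCC] := pselect (CC C); last by exists 0.
  by have [F FC] := CC_curves C CCC; exists F.
have [C0 CC0] : CC !=set0 by apply: infinite_set_nonempty.
have [Fd [F0 Fu F_irr] C0E] := eqnP C0 CC0; set F := eqn C0 in Fd F0 Fu F_irr C0E.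
have [mon [o [monF mono]]] := mpoly_irr_variable F0 Fu.
have [x [h [ox oh xh oxh]]] := third_variables o.
pose f := dehom o x 1 F.
have f_irr a b : f = a * b -> a \is a GRing.unit \/ b \is a GRing.unit.
  exact: (dehom_irr ox oh xh oxh Fd F_irr).
have f_deg : (1 < size f)%N := size_dehom ox oh xh oxh Fd monF mono.
have bidegP (G : {mpoly R[i][3]}) : G \is d.-homog -> bideg_lt d.+1 d.+1 (dehom o x 1 G).
  exact: bideg_dehom ox oh xh oxh.
have size_f : size f = (size f).-1.+1 by rewrite prednK // ltnW.
have m_gt0 : (0 < (size f).-1)%N by rewrite -ltnS -size_f.
have bideg_f : bideg_lt (size f).-1.+1 d.+1 f.
  by split; [rewrite -size_f | case: (bidegP F Fd)].
have /finite_seqP[X1 X1E] := finite_image (affine_coord x h) Sing_finite.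
have [X2 lead_fE] := closed_field_poly_normal (lead_coef f).
have f0 : f != 0 by rewrite -size_poly_gt0 ltnW.
(* The roots of the leading coefficient are excluded as well, so that all other fibers of [f] keep
   their full degree. *)
pose X := X1 ++ X2.
have lead_f t : (lead_coef f).[t] = 0 -> t \in X.
  move=> /eqP; rewrite -rootE lead_fE rootZ ?lead_coef_eq0 //.
  by rewrite root_prod_XsubC mem_cat => ->; rewrite orbT.
have [N [col colP]] := zeros_over_finite_classes d.+1 f_irr m_gt0 size_f bideg_f lead_f.
pose CC' := CC `\ C0.
have zeros C : CC' C -> zeros_over f X (dehom o x 1 (eqn C)).
  move=> [CCC neqC] t s ft gt; have [Gd _ CE] := eqnP C CCC.
  have [p Sp pt] := common_zeros_Sing ox oh xh oxh CC0 CCC neqC Fd C0E Gd CE ft gt.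
  suff : [set` X1] t by rewrite mem_cat => /= ->.
  by rewrite -X1E; exists p.
pose class k := [set C | CC' C /\ col (dehom o x 1 (eqn C)) = k].
(* Pigeonhole: [C0] and the finitely many classes exhaust the infinite collection. *)
have [k class_k] : exists k, infinite_set (class k).
  apply: contrapT => fin_class; apply: CC_infinite.
  apply: (@sub_finite_set _ _ ([set C0] `|` \bigcup_(k in [set: 'I_N]) class k)).
    move=> C CCC; have [->|neqC] := pselect (C = C0); first by left.
    by right; exists (col (dehom o x 1 (eqn C))).
  rewrite finite_setU; split=> //; apply: bigcup_finite => // k _.
  by apply: contrapT => inf_k; apply: fin_class; exists k.
have [D [[CCD neqD] Dk]] : class k !=set0 by apply: infinite_set_nonempty.
have [Gd [G0 _ _] DE] := eqnP D CCD; set G := eqn D in Gd G0 DE Dk.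
exists d, F, G; split=> //.
  (* Proportional [F] and [G] would have the same zero locus, whereas [D] differs from [C0]. *)
  split=> // c FGc; apply: neqD; rewrite DE C0E.
  have FcG : F = c *: G.
    apply/eqP; rewrite -tofrac_eq -mul_mpolyC tofracM -FGc divfK //.
    by rewrite tofrac_eq0.
  have c0 : c != 0 by apply: contra_neq F0 => c0; rewrite FcG c0 scale0r.
  rewrite FcG; apply/seteqP; split=> p Gp v /Gp; rewrite mevalZ.
    by move=> ->; rewrite mulr0.
  by move=> /eqP; rewrite mulf_eq0 (negbTE c0) => /eqP.
apply: sub_infinite_set class_k => C [[CCC neqC] Ck]; split=> //.
have [Hd [H0 _ _] CE] := eqnP C CCC; set H := eqn C in Hd H0 CE Ck.
have [z fHG] : exists z, divides f (dehom o x 1 H - z%:P%:P * dehom o x 1 G).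
  have [zH zG] := (zeros C (conj CCC neqC), zeros D (conj CCD neqD)).
  exact: (colP _ _ (bidegP H Hd) (bidegP G Gd) zH zG (etrans Ck (esym Dk))).
(* Two members of one class are proportional modulo [f]; the difference is a form of degree [d]
   divisible by [F], hence a scalar multiple of [F]. *)
have [e HE] : exists e, H - z *: G = e *: F.
  apply: (divides_dehom_scalar ox oh xh oxh Fd F_irr f_deg).
    by rewrite rpredB ?rpredZ.
  by rewrite dehom_subZ.
have HFG : H = e *: F + z *: G by rewrite -HE subrK.
exists e, z; rewrite -HFG; split=> //.
apply: contra_neq H0 => -[e0 z0]; by rewrite HFG e0 z0 !scale0r addr0.
Qed.
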